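(* Let $\lambda\ge0$. The critical points (common zeros of the right-hand sides) in $\{(S,U,P)\in\mathbb{R}^3: U\ge0\}$ of the system $$S'=-\tfrac{1}{3\sqrt3}-\tfrac23S+\tfrac1{\sqrt3}S^2+\tfrac1{\sqrt3}U^2+\tfrac1{2\sqrt3}P^2+2S^3-SU^2+SP^2,$$ $$U'=U\bigl(\tfrac13-\tfrac\lambda2P+2S^2-U^2+P^2\bigr),\qquad P'=-\tfrac23P+\lambda U^2+2S^2P-U^2P+P^3$$ are exactly the following: $P_1$: $S=-\frac1{2\sqrt3}$, $U=0$, $P=0$; $P_2$ (only if $\lambda\le\sqrt6$): $S=0$, $U=\sqrt{\frac{6-\lambda^2}{18}}$, $P=\frac\lambda3$; $P_3$: $S=\frac1{2\sqrt3}\,\frac{2-\lambda^2}{\lambda^2+1}$, $U=\frac{\sqrt{\lambda^2+2}}{\sqrt2(\lambda^2+1)}$, $P=\frac{\lambda}{\lambda^2+1}$; and the one-parameter family $\Sigma$: $U=0$, $3S^2+\frac32P^2=1$, with $S\in[-\sqrt{1/3},\sqrt{1/3}]$.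
   Context: The system arises from the Einstein–Klein–Gordon equations with exponential potential $V=V_0e^{-\lambda\varphi}$ in Bianchi I, Bianchi III and Kantowski–Sachs universes via $\sigma=S\theta$, $\sqrt V=U\theta$, $\psi=\dot\varphi=P\theta$, with $\theta>0$ the expansion, $\sigma$ the shear, and $'=\frac{d}{d\tau}=\frac1\theta\frac{d}{dt}$. *)

(* Defs.v *)
From Stdlib Require Import Reals.
Local Open Scope R_scope.

(* The expansion-normalised field equations: [S], [U], [P] are the variables
   with [sigma = S * theta], [sqrt V = U * theta], [psi = P * theta], and
   [lambda] is the exponent of the potential [V = V0 * exp (- lambda * phi)]. *)

Definition rhs_S (S U P : R) : R :=
  - (1 / (3 * sqrt 3)) - 2 / 3 * S + 1 / sqrt 3 * S ^ 2 + 1 / sqrt 3 * U ^ 2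
  + 1 / (2 * sqrt 3) * P ^ 2 + 2 * S ^ 3 - S * U ^ 2 + S * P ^ 2.

Definition rhs_U (lambda S U P : R) : R :=
  U * (1 / 3 - lambda / 2 * P + 2 * S ^ 2 - U ^ 2 + P ^ 2).

Definition rhs_P (lambda S U P : R) : R :=
  - (2 / 3) * P + lambda * U ^ 2 + 2 * S ^ 2 * P - U ^ 2 * P + P ^ 3.

Definition critical_point (lambda S U P : R) : Prop :=
  rhs_S S U P = 0 /\ rhs_U lambda S U P = 0 /\ rhs_P lambda S U P = 0.

Definition point_P1 (S U P : R) : Prop :=
  S = - (1 / (2 * sqrt 3)) /\ U = 0 /\ P = 0.

(* The bound on [lambda] is essential: [sqrt] is total and returns [0] on
   negative arguments. *)
Definition point_P2 (lambda S U P : R) : Prop :=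
  lambda <= sqrt 6 /\
  S = 0 /\ U = sqrt ((6 - lambda ^ 2) / 18) /\ P = lambda / 3.

Definition point_P3 (lambda S U P : R) : Prop :=
  S = 1 / (2 * sqrt 3) * ((2 - lambda ^ 2) / (lambda ^ 2 + 1)) /\
  U = sqrt (lambda ^ 2 + 2) / (sqrt 2 * (lambda ^ 2 + 1)) /\
  P = lambda / (lambda ^ 2 + 1).

Definition family_Sigma (S U P : R) : Prop :=
  U = 0 /\ 3 * S ^ 2 + 3 / 2 * P ^ 2 = 1 /\
  - sqrt (1 / 3) <= S <= sqrt (1 / 3).

(* Main.v *)
Require Import Defs.
From Stdlib Require Import Reals Lra.
Local Open Scope R_scope.

(** Put [k = 1 / sqrt 3] and [D = 3 S^2 + 3/2 P^2 - 1].  Then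
    [S' = D (2 S + k) / 3 + U^2 (k - S)] and [P' = P (2/3 D - U^2) + lambda U^2],
    which settles the case [U = 0].  If [U <> 0], then [U' = 0] expresses [U^2]
    through [S] and [P], and the other two equations become
    [(3 P - lambda) (lambda P / 2 - 1 / 3) + 2 lambda S^2 = 0] and
    [3 k S^2 + S (lambda P / 2 - 1) + k P / 2 (3 P - lambda) = 0].
    If [S = 0], they give [P2].  Otherwise eliminating [3 P - lambda] gives
    [(1 - lambda P / 2) (k S + lambda P / 2 - 1 / 3) = 0], whose first factor
    cannot vanish and whose second one gives [P3]. *)

Lemma inv_sqrt3_sqr : (1 / sqrt 3) ^ 2 = 1 / 3.
Proof.
  assert (h : sqrt 3 * sqrt 3 = 3) by (apply sqrt_sqrt; lra).
  assert (0 < sqrt 3) by (apply sqrt_lt_R0; lra).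
  replace ((1 / sqrt 3) ^ 2) with (1 / (sqrt 3 * sqrt 3)) by (field; lra).
  now rewrite h.
Qed.

(** Makes [1 / sqrt 3] the only irrational atom, so that it can be generalized to a variable [k] and
    the rest is rational algebra. *)
Lemma inv_mul_sqrt3 (a : R) : a <> 0 -> 1 / (a * sqrt 3) = (1 / sqrt 3) / a.
Proof.
  intro ha.
  assert (0 < sqrt 3) by (apply sqrt_lt_R0; lra).
  field; lra.
Qed.

Lemma rhs_S_factored (S U P : R) :
  rhs_S S U P = (3 * S ^ 2 + 3 / 2 * P ^ 2 - 1) * (2 * S + 1 / sqrt 3) / 3
                + U ^ 2 * (1 / sqrt 3 - S).
Proof.
  unfold rhs_S.
  rewrite !inv_mul_sqrt3 by lra.
  set (k := 1 / sqrt 3).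
  field.
Qed.

Lemma rhs_P_factored (lambda S U P : R) :
  rhs_P lambda S U P = P * (2 / 3 * (3 * S ^ 2 + 3 / 2 * P ^ 2 - 1) - U ^ 2)
                       + lambda * U ^ 2.
Proof. unfold rhs_P; field. Qed.

Lemma eq_sqrt_iff (x y : R) : 0 <= y -> x = sqrt y <-> 0 <= x /\ x ^ 2 = y.
Proof.
  intro hy; split.
  - intros ->; split; [apply sqrt_pos | now apply pow2_sqrt].
  - intros [hx <-]; now rewrite sqrt_pow2.
Qed.

Lemma le_sqrt_iff (x y : R) : 0 <= x -> 0 <= y -> x <= sqrt y <-> x ^ 2 <= y.
Proof.
  intros hx hy.
  pose proof (sqrt_pos y) as hs.
  pose proof (pow2_sqrt y hy) as hs2.
  split; intro h; nra.
Qed.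

(** Trades the square root for a sign and a square; the bound on [lambda] is then carried by
    [U ^ 2 >= 0]. *)
Lemma point_P2_iff (lambda S U P : R) : 0 <= lambda ->
  point_P2 lambda S U P <->
  0 <= U /\ S = 0 /\ U ^ 2 = (6 - lambda ^ 2) / 18 /\ P = lambda / 3.
Proof.
  intro hl; unfold point_P2.
  rewrite le_sqrt_iff by lra.
  split.
  - intros (h & hS & hU & hP).
    apply eq_sqrt_iff in hU; [tauto | lra].
  - intros (hU0 & hS & hU & hP).
    assert (lambda ^ 2 <= 6) by (pose proof (pow2_ge_0 U); lra).
    rewrite eq_sqrt_iff by lra; tauto.
Qed.

Lemma point_P3_iff (lambda S U P : R) :
  point_P3 lambda S U P <->
  0 <= U /\ S = (1 / sqrt 3) / 2 * ((2 - lambda ^ 2) / (lambda ^ 2 + 1)) /\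
  U ^ 2 = (lambda ^ 2 + 2) / (2 * (lambda ^ 2 + 1) ^ 2) /\
  P = lambda / (lambda ^ 2 + 1).
Proof.
  unfold point_P3.
  pose proof (pow2_ge_0 lambda) as hl.
  assert (0 < sqrt 2) by (apply sqrt_lt_R0; lra).
  assert (hd : 0 < 2 * (lambda ^ 2 + 1) ^ 2) by nra.
  (* Merging the radicals into a single root makes [eq_sqrt_iff] applicable. *)
  replace (sqrt (lambda ^ 2 + 2) / (sqrt 2 * (lambda ^ 2 + 1)))
    with (sqrt ((lambda ^ 2 + 2) / (2 * (lambda ^ 2 + 1) ^ 2))).
  - rewrite eq_sqrt_iff by (apply Rlt_le, Rdiv_lt_0_compat; lra).
    rewrite inv_mul_sqrt3 by lra.
    tauto.
  - rewrite sqrt_div by lra.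
    rewrite sqrt_mult by nra.
    rewrite sqrt_pow2 by lra.
    reflexivity.
Qed.

Lemma family_Sigma_iff (S U P : R) :
  family_Sigma S U P <-> U = 0 /\ 3 * S ^ 2 + 3 / 2 * P ^ 2 = 1.
Proof.
  unfold family_Sigma; split; [tauto |].
  intros [hU h]; split; [exact hU |]; split; [exact h |].
  pose proof (sqrt_pos (1 / 3)) as hs.
  assert (hs2 : sqrt (1 / 3) ^ 2 = 1 / 3) by (apply pow2_sqrt; lra).
  pose proof (pow2_ge_0 P).
  split; nra.
Qed.

Lemma point_P1_critical (lambda S U P : R) :
  point_P1 S U P -> critical_point lambda S U P.
Proof.
  intros (hS & hU & hP); rewrite inv_mul_sqrt3 in hS by lra.
  unfold critical_point; rewrite rhs_S_factored; unfold rhs_U, rhs_P.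
  subst; repeat split; generalize (1 / sqrt 3); intro; field.
Qed.

Lemma point_P2_critical (lambda S U P : R) :
  S = 0 -> U ^ 2 = (6 - lambda ^ 2) / 18 -> P = lambda / 3 ->
  critical_point lambda S U P.
Proof.
  intros -> hU ->.
  unfold critical_point; rewrite rhs_S_factored; unfold rhs_U, rhs_P.
  rewrite hU; repeat split; generalize (1 / sqrt 3); intro; field.
Qed.

Lemma point_P3_critical (lambda S U P : R) :
  S = (1 / sqrt 3) / 2 * ((2 - lambda ^ 2) / (lambda ^ 2 + 1)) ->
  U ^ 2 = (lambda ^ 2 + 2) / (2 * (lambda ^ 2 + 1) ^ 2) ->
  P = lambda / (lambda ^ 2 + 1) ->
  critical_point lambda S U P.
Proof.
  intros hS hU hP.
  pose proof (pow2_ge_0 lambda) as hl.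
  (* The value of [k ^ 2] enters only here: once [S ^ 2] is rational in [lambda], [rhs_S] is [k]
     times a rational function, which vanishes identically. *)
  assert (hS2 : S ^ 2 = 1 / 12 * ((2 - lambda ^ 2) / (lambda ^ 2 + 1)) ^ 2).
  { rewrite hS, Rpow_mult_distr.
    replace ((1 / sqrt 3 / 2) ^ 2) with ((1 / sqrt 3) ^ 2 / 4)
      by (generalize (1 / sqrt 3); intro; field).
    rewrite inv_sqrt3_sqr; field; lra. }
  unfold critical_point; rewrite rhs_S_factored; unfold rhs_U, rhs_P.
  rewrite hS2, hU, hP, hS.
  repeat split; generalize (1 / sqrt 3); intro; field; lra.
Qed.

Lemma family_Sigma_critical (lambda S U P : R) :
  U = 0 -> 3 * S ^ 2 + 3 / 2 * P ^ 2 = 1 -> critical_point lambda S U P.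
Proof.
  intros -> h.
  unfold critical_point; rewrite rhs_S_factored, rhs_P_factored, h; unfold rhs_U.
  repeat split; unfold Rdiv; ring.
Qed.

Lemma critical_vacuum (lambda S P : R) :
  critical_point lambda S 0 P -> point_P1 S 0 P \/ family_Sigma S 0 P.
Proof.
  unfold critical_point; rewrite rhs_S_factored, rhs_P_factored, family_Sigma_iff.
  unfold point_P1; rewrite inv_mul_sqrt3 by lra.
  generalize (1 / sqrt 3); intros k (hS & _ & hP).
  destruct (Req_dec (3 * S ^ 2 + 3 / 2 * P ^ 2 - 1) 0) as [h | h].
  - right; lra.
  - left.
    (* Cancelling [D] leaves [2 S + k = 0] and [P = 0]. *)
    split; [| split; [reflexivity |]]; apply (Rmult_eq_reg_l _ _ _) with (2 := h); lra.
Qed.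

Lemma critical_nonvacuum (lambda S U P : R) :
  0 <= lambda -> 0 < U -> critical_point lambda S U P ->
  point_P2 lambda S U P \/ point_P3 lambda S U P.
Proof.
  intros hl hU.
  rewrite (point_P2_iff _ _ _ _ hl), point_P3_iff.
  unfold critical_point; rewrite rhs_S_factored; unfold rhs_U, rhs_P.
  (* From here on, [k ^ 2 = 1 / 3] is all that is known of [k]. *)
  pose proof inv_sqrt3_sqr as hk; revert hk.
  generalize (1 / sqrt 3); intros k hk (hS & hU' & hP).
  assert (hU2 : U ^ 2 = 2 * S ^ 2 + P ^ 2 - lambda * P / 2 + 1 / 3).
  { apply Rmult_integral in hU'; destruct hU'; lra. }
  assert (hpos : 0 < U ^ 2) by (apply pow_lt; exact hU).
  assert (hA : (3 * P - lambda) * (lambda * P / 2 - 1 / 3)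
               + 2 * lambda * S ^ 2 = 0).
  { rewrite hU2 in hP; lra. }
  assert (hB : 3 * k * S ^ 2 + S * (lambda * P / 2 - 1)
               + k * P / 2 * (3 * P - lambda) = 0).
  { rewrite hU2 in hS; lra. }
  destruct (Req_dec S 0) as [h0 | h0].
  - left.
    rewrite h0 in *.
    (* Otherwise [hB] forces [P = 0], and then [hA] reads [lambda / 3 = 0], so [3 P - lambda]
       vanishes after all. *)
    assert (hE : 3 * P - lambda = 0).
    { destruct (Req_dec (3 * P - lambda) 0) as [e | e]; [exact e | exfalso].
      assert (k <> 0) by (intro; subst; lra).
      assert (hP0 : P = 0).
      { assert (hz : (k * (3 * P - lambda)) * P = 0) by lra.
        apply Rmult_integral in hz as [hz | hz]; [| exact hz].
        apply Rmult_integral in hz; tauto. }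
      subst P; lra. }
    assert (hP' : P = lambda / 3) by lra.
    rewrite hU2, hP'; repeat split; lra.
  - right.
    (* In this combination of [hA] and [hB] the terms with [3 P - lambda] cancel, and every other
       term contains [S]. *)
    assert (hfac : S * ((1 - lambda * P / 2) * (k * S + lambda * P / 2 - 1 / 3)) = 0).
    { transitivity (k * P / 2 * ((3 * P - lambda) * (lambda * P / 2 - 1 / 3)
                                 + 2 * lambda * S ^ 2)
                    - (lambda * P / 2 - 1 / 3)
                      * (3 * k * S ^ 2 + S * (lambda * P / 2 - 1)
                         + k * P / 2 * (3 * P - lambda))).
      - field.
      - rewrite hA, hB; ring. }
    apply Rmult_integral in hfac as [? | hfac]; [contradiction |].
    apply Rmult_integral in hfac as [hlP | hfac].
    + exfalso.
      (* With [U' = 0], the equation for [P] is [P (lambda P / 2 - 1) + lambda U^2 = 0], and here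
         [lambda P = 2]. *)
      assert (hz : lambda * U ^ 2 = 0).
      { transitivity (P * (1 - lambda * P / 2)
                      + (P * (lambda * P / 2 - 1) + lambda * U ^ 2)); [field |].
        rewrite hlP, hU2; lra. }
      apply Rmult_integral in hz as [-> | hz]; lra.
    (* The vanishing factor turns [lambda P / 2 - 1 / 3] in [hA] into [- k S]; then [S] cancels. *)
    + assert (hE : k * (3 * P - lambda) = 2 * lambda * S).
      { apply Rmult_eq_reg_l with S; [| exact h0].
        replace (lambda * P / 2 - 1 / 3) with (- (k * S)) in hA by lra.
        lra. }
      assert (hS' : S = k * (1 - 3 * lambda * P / 2)).
      (* Solves for [S] by writing [S = 3 k^2 S = 3 k (k S)]. *)
      { transitivity (3 * (1 / 3) * S); [field |].
        rewrite <- hk.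
        transitivity (3 * k * (k * S)); [ring |].
        replace (k * S) with (1 / 3 - lambda * P / 2) by lra.
        field. }
      assert (hl2 : 0 <= lambda ^ 2) by apply pow2_ge_0.
      assert (hP' : P = lambda / (lambda ^ 2 + 1)).
      (* Inserting [hS'] into [hE] and cancelling [k] gives [3 (lambda^2 + 1) P = 3 lambda]. *)
      { apply Rmult_eq_reg_l with (3 * (lambda ^ 2 + 1)); [| lra].
        transitivity (3 * lambda); [| field; lra].
        assert (k <> 0) by (intro; subst; lra).
        apply Rmult_eq_reg_l with k; [| assumption].
        rewrite hS' in hE; lra. }
      assert (hS2 : S ^ 2 = 1 / 3 * (1 - 3 * lambda * P / 2) ^ 2)
        by (rewrite <- hk, hS'; ring).
      rewrite hU2, hS2, hS', hP'.
      repeat split; first [lra | field; lra].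
Qed.

Theorem mainTheorem2 (lambda : R) (hlambda : 0 <= lambda) :
  forall S U P : R,
    (0 <= U /\ critical_point lambda S U P) <->
    (point_P1 S U P \/ point_P2 lambda S U P \/ point_P3 lambda S U P \/
     family_Sigma S U P).
Proof.
  intros S U P; split.
  - intros [hU hc].
    destruct hU as [hU | <-].
    + destruct (critical_nonvacuum _ _ _ _ hlambda hU hc); tauto.
    + destruct (critical_vacuum _ _ _ hc); tauto.
  - intros [h | [h | [h | h]]].
    + split; [destruct h as (_ & -> & _); lra | now apply point_P1_critical].
    + apply point_P2_iff in h as (hU & h0 & h1 & h2); [| exact hlambda].
      split; [exact hU | now apply point_P2_critical].
    + apply point_P3_iff in h as (hU & h0 & h1 & h2).
      split; [exact hU | now apply point_P3_critical].
    + apply family_Sigma_iff in h as [hU h].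
      split; [lra | now apply family_Sigma_critical].
Qed.
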